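(* Let $q:\mathbb{R}^2\to\mathbb{C}^N$ be smooth, let $n\ge1$, and for $j=1,\dots,n$ let $\Phi_j$ be a solution of the Lax pair at $\lambda=\lambda_j$, where $\lambda_j\neq\overline{\lambda_i}$ whenever $i\neq j$. Let $\Phi$ be a solution at $\lambda$ with $\lambda\notin\{\overline{\lambda_1},\dots,\overline{\lambda_n}\}$. Define the $n\times n$ matrix $M=(M_{ij})$ by $M_{ij}=\dfrac{\Phi_i^{\dagger}\Lambda\Phi_j}{\mathrm{i}(\lambda_j-\overline{\lambda_i})}$ for $i\neq j$ and for $i=j$ with $\lambda_i\notin\mathbb{R}$; for $i$ with $\lambda_i\in\mathbb{R}$ assume $\Phi_i^{\dagger}\Lambda\Phi_i\equiv0$ and let $M_{ii}$ be a real-valued smooth function with $dM_{ii}=\omega(\Phi_i,\Phi_i)$. Assume $M$ is invertible everywhere. Let $Y=(\Phi_1,\dots,\Phi_n)$ be the $(N+1)\times n$ matrix with columns $\Phi_j$ and let $\Omega$ be the column vector with entries $\Omega_i=\dfrac{\Phi_i^{\dagger}\Lambda\Phi}{\mathrm{i}(\lambda-\overline{\lambda_i})}$. Set $$\Phi[n]=\Phi-YM^{-1}\Omega,\qquad Q[n]=Q-\mathrm{i}\big[\sigma_3,\;YM^{-1}Y^{\dagger}\Lambda\big].$$ Then $\Phi[n]_x=(\mathrm{i}\lambda\sigma_3+\mathrm{i}Q[n])\Phi[n]$ and $\Phi[n]_t=\big(\mathrm{i}\lambda^2\sigma_3+\mathrm{i}\lambda Q[n]-\tfrac12(\mathrm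{i}\sigma_3Q[n]^2-\sigma_3Q[n]_x)\big)\Phi[n]$.
   Context: Fix integers $N\ge1$ and $0\le k\le N$, and let $S=\mathrm{diag}(s_1,\dots,s_N)$ with $s_l=1$ for $l\le k$ and $s_l=-1$ for $l>k$. The $N$-component NLS equation is $\mathrm{i}\mathbf q_t+\tfrac12\mathbf q_{xx}-\mathbf q\,(\mathbf q^{\dagger}S\mathbf q)=0$ for $\mathbf q=(q_1,\dots,q_N)^T:\mathbb{R}^2\to\mathbb{C}^N$ (here ${}^\dagger$ is conjugate transpose). Its Lax pair is $\Phi_x=(\mathrm{i}\lambda\sigma_3+\mathrm{i}Q)\Phi$, $\Phi_t=\big(\mathrm{i}\lambda^2\sigma_3+\mathrm{i}\lambda Q-\tfrac12(\mathrm{i}\sigma_3Q^2-\sigma_3Q_x)\big)\Phi$, for $\Phi:\mathbb{R}^2\to\mathbb{C}^{N+1}$ and spectral parameter $\lambda\in\mathbb{C}$, where $Q=\begin{pmatrix}0&-\mathbf q^{\dagger}S\\ \mathbf q&0_{N\times N}\end{pmatrix}$ and $\sigma_3=\mathrm{diag}(1,-I_N)$. A ''solution at $\lambda$'' is a smooth $\Phi$ satisfying both equations with that value of $\lambda$. Let $\Lambda=\mathrm{diag}(1,-s_1,\dots,-s_N)$ (i.e. $1$, then $-1$ repeated $k$ times, then $1$ repeated $N-k$ times). For a solution $\Phi_1$ at $\lambda_1$ and a solution $\Phi$ at $\lambda$, $\omega(\Phi_1,\Phi)$ denotes the $1$-form $\Phi_1^{\dagger}\Lambda\sigma_3\Phi\,dx+[(\lambda+\overline{\lambda_1})\Phi_1^{\dagger}\Lambda\sigma_3\Phi+\Phi_1^{\dagger}\Lambda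 Q\Phi]\,dt$. $[A,B]=AB-BA$. *)

(* Defs.v *)
From Stdlib Require Import Reals.
Open Scope R_scope.

Record Cplx : Type := mkC { Re : R; Im : R }.

Definition C0 : Cplx := mkC 0 0.
Definition C1 : Cplx := mkC 1 0.
Definition Ci : Cplx := mkC 0 1.
Definition CR (r : R) : Cplx := mkC r 0.
Definition Cadd (a b : Cplx) : Cplx := mkC (Re a + Re b) (Im a + Im b).
Definition Copp (a : Cplx) : Cplx := mkC (- Re a) (- Im a).
Definition Csub (a b : Cplx) : Cplx := Cadd a (Copp b).
Definition Cmul (a b : Cplx) : Cplx :=
  mkC (Re a * Re b - Im a * Im b) (Re a * Im b + Im a * Re b).
Definition Cconj (a : Cplx) : Cplx := mkC (Re a) (- Im a).
Definition Cinv (a : Cplx) : Cplx :=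
  mkC (Re a / (Re a * Re a + Im a * Im a)) (- Im a / (Re a * Re a + Im a * Im a)).
Definition Cdiv (a b : Cplx) : Cplx := Cmul a (Cinv b).

Fixpoint Csum (n : nat) (f : nat -> Cplx) : Cplx :=
  match n with
  | O => C0
  | S m => Cadd (Csum m f) (f m)
  end.

(* ---------- vectors / matrices (indices 0 .. d-1; entries outside are junk) *)
Definition vec := nat -> Cplx.
Definition mat := nat -> nat -> Cplx.

Definition madd (A B : mat) : mat := fun i j => Cadd (A i j) (B i j).
Definition msub (A B : mat) : mat := fun i j => Csub (A i j) (B i j).
Definition mscale (c : Cplx) (A : mat) : mat := fun i j => Cmul c (A i j).
Definition mmul (p : nat) (A B : mat) : mat :=
  fun i j => Csum p (fun l => Cmul (A i l) (B l j)).
Definition mvmul (p : nat) (A : mat) (v : vec) : vec :=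
  fun i => Csum p (fun l => Cmul (A i l) (v l)).
Definition madj (A : mat) : mat := fun i j => Cconj (A j i).
Definition idm : mat := fun i j => if Nat.eqb i j then C1 else C0.
Definition cdot (d : nat) (u w : vec) : Cplx :=
  Csum d (fun l => Cmul (Cconj (u l)) (w l)).
Definition comm (p : nat) (A B : mat) : mat := msub (mmul p A B) (mmul p B A).

Definition pd_x (f g : R -> R -> R) : Prop :=
  forall x t, derivable_pt_lim (fun s => f s t) x (g x t).
Definition pd_t (f g : R -> R -> R) : Prop :=
  forall x t, derivable_pt_lim (fun s => f x s) t (g x t).
Definition cont2 (f : R -> R -> R) : Prop :=
  forall x t eps, 0 < eps -> exists delta, 0 < delta /\
    forall x' t', Rabs (x' - x) < delta -> Rabs (t' - t) < delta ->
      Rabs (f x' t' - f x t) < eps.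
(* Cplx^infinity on R^2: f lies in a family of jointly continuous functions
   closed under both partial derivatives *)
Definition smoothR (f : R -> R -> R) : Prop :=
  exists P : (R -> R -> R) -> Prop, P f /\
    forall g, P g -> cont2 g /\
      exists gx gt, pd_x g gx /\ pd_t g gt /\ P gx /\ P gt.

Definition smoothC (F : R -> R -> Cplx) : Prop :=
  smoothR (fun x t => Re (F x t)) /\ smoothR (fun x t => Im (F x t)).
Definition cpd_x (F G : R -> R -> Cplx) : Prop :=
  pd_x (fun x t => Re (F x t)) (fun x t => Re (G x t)) /\
  pd_x (fun x t => Im (F x t)) (fun x t => Im (G x t)).
Definition cpd_t (F G : R -> R -> Cplx) : Prop :=
  pd_t (fun x t => Re (F x t)) (fun x t => Re (G x t)) /\
  pd_t (fun x t => Im (F x t)) (fun x t => Im (G x t)).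

Definition vsmooth (d : nat) (F : R -> R -> vec) : Prop :=
  forall a, (a < d)%nat -> smoothC (fun x t => F x t a).
Definition vpd_x (d : nat) (F G : R -> R -> vec) : Prop :=
  forall a, (a < d)%nat -> cpd_x (fun x t => F x t a) (fun x t => G x t a).
Definition vpd_t (d : nat) (F G : R -> R -> vec) : Prop :=
  forall a, (a < d)%nat -> cpd_t (fun x t => F x t a) (fun x t => G x t a).
Definition mpd_x (d : nat) (F G : R -> R -> mat) : Prop :=
  forall a b, (a < d)%nat -> (b < d)%nat ->
    cpd_x (fun x t => F x t a b) (fun x t => G x t a b).

(* The components q_1..q_N of q are q x t 1, ..., q x t N (entry 0 unused).
   Matrix indices of (N+1)x(N+1) matrices run over 0..N, index 0 being the
   first ("scalar") slot. *)
Definition sgn (k l : nat) : R := if Nat.leb l k then 1 else -1.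

Definition Qof (k : nat) (q : vec) : mat :=
  fun i j =>
    match i, j with
    | O, O => C0
    | O, S _ => Copp (Cmul (Cconj (q j)) (CR (sgn k j)))
    | S _, O => q i
    | S _, S _ => C0
    end.

Definition sigma3 : mat :=
  fun i j => if Nat.eqb i j then (if Nat.eqb i 0 then C1 else CR (-1)) else C0.

Definition Lam (k : nat) : mat :=
  fun i j => if Nat.eqb i j then (if Nat.eqb i 0 then C1 else CR (- sgn k i))
             else C0.

Definition Umat (lam : Cplx) (Q : mat) : mat :=
  madd (mscale (Cmul Ci lam) sigma3) (mscale Ci Q).
Definition Vmat (d : nat) (lam : Cplx) (Q Qx : mat) : mat :=
  msub (madd (mscale (Cmul Ci (Cmul lam lam)) sigma3) (mscale (Cmul Ci lam) Q))
       (mscale (CR (1/2))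
          (msub (mscale Ci (mmul d sigma3 (mmul d Q Q))) (mmul d sigma3 Qx))).

Definition lax_x (d : nat) (Qf : R -> R -> mat) (lam : Cplx) (Phi : R -> R -> vec) :=
  vpd_x d Phi (fun x t => mvmul d (Umat lam (Qf x t)) (Phi x t)).
Definition lax_t (d : nat) (Qf Qxf : R -> R -> mat) (lam : Cplx)
  (Phi : R -> R -> vec) :=
  vpd_t d Phi (fun x t => mvmul d (Vmat d lam (Qf x t) (Qxf x t)) (Phi x t)).

Definition lax_solution (d : nat) (Qf Qxf : R -> R -> mat) (lam : Cplx)
  (Phi : R -> R -> vec) : Prop :=
  vsmooth d Phi /\ lax_x d Qf lam Phi /\ lax_t d Qf Qxf lam Phi.

(* the 1-form omega(Phi1,Phi) : dx- and dt-coefficients *)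
Definition omega_x (d k : nat) (Phi1 Phi : vec) : Cplx :=
  cdot d Phi1 (mvmul d (Lam k) (mvmul d sigma3 Phi)).
Definition omega_t (d k : nat) (lam1 lam : Cplx) (Q : mat) (Phi1 Phi : vec) : Cplx :=
  Cadd (Cmul (Cadd lam (Cconj lam1)) (cdot d Phi1 (mvmul d (Lam k) (mvmul d sigma3 Phi))))
       (cdot d Phi1 (mvmul d (Lam k) (mvmul d Q Phi))).

(* Main.v *)
Require Import Defs.
From Stdlib Require Import Reals Lra Classical.
From HB Require structures.
From mathcomp Require all_boot all_algebra perm ring Rstruct.
Open Scope R_scope.

(** Put s = i sigma_3, u = iQ, Z = Y^dagger Lambda, m = iM, w = m^-1 and
    L = diag(lambda_j).  Then s^2 = -1, us = -su, and every entry of m,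
    including those at real lambda_i, obeys m L - L^dagger m = Z Y,
    m_x = Z s Y and m_t = Z s Y L + L^dagger Z s Y + Z u Y, because s, u, u_x
    are skew for the form given by Lambda.  With p = Y w Z, the spectral
    identity L w = w L^dagger + w Z Y w turns the derivatives of
    Phi - Y w (i Omega) into the Lax matrices with u replaced by u + [s, p],
    up to the extra term p_x in the t-equation.  That term is accounted for by
    the identity p_x - s p_x s = s (u D + D u + D^2), where D = [s, p]. *)

(** * Arithmetic of [Cplx] *)

Lemma Cplx_eq (a b : Cplx) : Re a = Re b -> Im a = Im b -> a = b.
Proof. destruct a, b; simpl; congruence. Qed.

Ltac cplx := intros; apply Cplx_eq; simpl; ring.

Lemma Cadd_assoc a b c : Cadd a (Cadd b c) = Cadd (Cadd a b) c. Proof. cplx. Qed.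
Lemma Cadd_comm a b : Cadd a b = Cadd b a. Proof. cplx. Qed.
Lemma Cadd_0_l a : Cadd C0 a = a. Proof. cplx. Qed.
Lemma Cadd_opp_l a : Cadd (Copp a) a = C0. Proof. cplx. Qed.
Lemma Cmul_assoc a b c : Cmul a (Cmul b c) = Cmul (Cmul a b) c. Proof. cplx. Qed.
Lemma Cmul_comm a b : Cmul a b = Cmul b a. Proof. cplx. Qed.
Lemma Cmul_1_l a : Cmul Defs.C1 a = a. Proof. cplx. Qed.
Lemma Cmul_add_l a b c : Cmul (Cadd a b) c = Cadd (Cmul a c) (Cmul b c).
Proof. cplx. Qed.
Lemma C1_neq_0 : Defs.C1 <> C0.
Proof. intros H; injection H; lra. Qed.

Lemma Cnorm2_neq_0 a : a <> C0 -> Re a * Re a + Im a * Im a <> 0.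
Proof.
intros Ha H; apply Ha, Cplx_eq; simpl; nra.
Qed.

Lemma Cmul_inv_l a : a <> C0 -> Cmul (Cinv a) a = Defs.C1.
Proof.
intros Ha%Cnorm2_neq_0; apply Cplx_eq; simpl; field; exact Ha.
Qed.

(** The field structure declared below asks for this. Both numerators vanish, so the value given to
    a division by zero does not matter. *)
Lemma Cinv_0 : Cinv C0 = C0.
Proof. apply Cplx_eq; simpl; unfold Rdiv; ring. Qed.

Lemma Cconj_add a b : Cconj (Cadd a b) = Cadd (Cconj a) (Cconj b). Proof. cplx. Qed.
Lemma Cconj_opp a : Cconj (Copp a) = Copp (Cconj a). Proof. cplx. Qed.
Lemma Cconj_mul a b : Cconj (Cmul a b) = Cmul (Cconj a) (Cconj b). Proof. cplx. Qed.
Lemma Cconj_1 : Cconj Defs.C1 = Defs.C1. Proof. cplx. Qed.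

(** * Differentiation of complex functions of a real variable *)

Definition is_dC (f : R -> Cplx) (x : R) (l : Cplx) : Prop :=
  derivable_pt_lim (fun s => Re (f s)) x (Re l) /\
  derivable_pt_lim (fun s => Im (f s)) x (Im l).

Lemma derivable_pt_lim_congr f g x l l' :
  (forall s, f s = g s) -> l = l' ->
  derivable_pt_lim f x l -> derivable_pt_lim g x l'.
Proof. intros E -> H; exact (derivable_pt_lim_ext f g x l' E H). Qed.

Lemma is_dC_ext f g x l :
  (forall s, f s = g s) -> is_dC f x l -> is_dC g x l.
Proof.
intros E [H1 H2]; split; eapply derivable_pt_lim_ext; try eassumption;
  intros s; simpl; now rewrite E.
Qed.

Lemma is_dC_unique f x l l' : is_dC f x l -> is_dC f x l' -> l = l'.
Proof. intros [? ?] [? ?]; apply Cplx_eq; eapply uniqueness_limite; eassumption. Qed.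

Lemma is_dC_const c x : is_dC (fun _ => c) x C0.
Proof. split; apply derivable_pt_lim_const. Qed.

Lemma is_dC_add f g x l l' :
  is_dC f x l -> is_dC g x l' -> is_dC (fun s => Cadd (f s) (g s)) x (Cadd l l').
Proof. intros [? ?] [? ?]; split; simpl; apply derivable_pt_lim_plus; assumption. Qed.

Lemma is_dC_opp f x l : is_dC f x l -> is_dC (fun s => Copp (f s)) x (Copp l).
Proof. intros [? ?]; split; simpl; apply derivable_pt_lim_opp; assumption. Qed.

Lemma is_dC_conj f x l : is_dC f x l -> is_dC (fun s => Cconj (f s)) x (Cconj l).
Proof. intros [? ?]; split; simpl; [|apply derivable_pt_lim_opp]; assumption. Qed.

Lemma is_dC_mul f g x l l' :
  is_dC f x l -> is_dC g x l' ->
  is_dC (fun s => Cmul (f s) (g s)) x (Cadd (Cmul l (g x)) (Cmul (f x) l')).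
Proof.
intros [f1 f2] [g1 g2]; split.
- eapply derivable_pt_lim_congr; [| |exact (derivable_pt_lim_minus _ _ _ _ _
    (derivable_pt_lim_mult _ _ _ _ _ f1 g1) (derivable_pt_lim_mult _ _ _ _ _ f2 g2))].
  + reflexivity.
  + simpl; ring.
- eapply derivable_pt_lim_congr; [| |exact (derivable_pt_lim_plus _ _ _ _ _
    (derivable_pt_lim_mult _ _ _ _ _ f1 g2) (derivable_pt_lim_mult _ _ _ _ _ f2 g1))].
  + reflexivity.
  + simpl; ring.
Qed.

(** Existence is enough: the derivative of an inverse matrix is computed later by differentiating a
    product equal to 1. *)
Lemma ex_is_dC_inv f x l :
  is_dC f x l -> f x <> C0 -> exists l', is_dC (fun s => Cinv (f s)) x l'.
Proof.
intros [f1 f2] Hx%Cnorm2_neq_0.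
pose proof (derivable_pt_lim_plus _ _ _ _ _
  (derivable_pt_lim_mult _ _ _ _ _ f1 f1) (derivable_pt_lim_mult _ _ _ _ _ f2 f2)) as Hn.
eexists (mkC ?[a] ?[b]); split.
- exact (derivable_pt_lim_div _ _ _ _ _ f1 Hn Hx).
- exact (derivable_pt_lim_div _ _ _ _ _ (derivable_pt_lim_opp _ _ _ f2) Hn Hx).
Qed.

(** * Constants and entrywise symmetries of sigma_3, Lambda and Q *)

Definition Chalf : Cplx := CR (1 / 2).
Lemma Chalf_add : Cadd Chalf Chalf = Defs.C1.
Proof. apply Cplx_eq; simpl; lra. Qed.
Lemma Cconj_half : Cconj Chalf = Chalf. Proof. cplx. Qed.
Lemma Ci_mul : Cmul Ci Ci = Copp Defs.C1. Proof. cplx. Qed.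
Lemma Cconj_i : Cconj Ci = Copp Ci. Proof. cplx. Qed.
Lemma Ci_neq_0 : Ci <> C0.
Proof. intros H; injection H; lra. Qed.

Lemma Cconj_real a : Im a = 0 -> Cconj a = a.
Proof. intros H; apply Cplx_eq; simpl; lra. Qed.
Lemma Cconj_neq a : Im a <> 0 -> a <> Cconj a.
Proof. intros H E; apply H; apply (f_equal Im) in E; simpl in E; lra. Qed.

Definition sigma3_diag (i : nat) : Cplx := if Nat.eqb i 0 then Defs.C1 else CR (-1).
Definition Lam_diag (k i : nat) : Cplx := if Nat.eqb i 0 then Defs.C1 else CR (- sgn k i).

Lemma sigma3_diag_sqr i : Cmul (sigma3_diag i) (sigma3_diag i) = Defs.C1.
Proof. destruct i; cplx. Qed.
Lemma Cconj_sigma3_diag i : Cconj (sigma3_diag i) = sigma3_diag i.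
Proof. destruct i; cplx. Qed.
Lemma Qof_sigma3 k q i j :
  Cmul (Qof k q i j) (sigma3_diag j) = Copp (Cmul (sigma3_diag i) (Qof k q i j)).
Proof. destruct i, j; cplx. Qed.
(** The weights -s_l of Lambda match the signs in the first row of Q. Thus Q is self-adjoint for the
    form Lambda, and iQ will be skew. *)
Lemma Qof_Lam k q i j :
  Cmul (Cconj (Qof k q j i)) (Lam_diag k j) = Cmul (Lam_diag k i) (Qof k q i j).
Proof.
destruct i, j; unfold Lam_diag; apply Cplx_eq; simpl; ring.
Qed.

Module DarbouxMatrices.
Import HB.structures.
Import all_boot all_algebra perm ring Rstruct.
Import GRing.Theory.
Set Implicit Arguments.
Unset Strict Implicit.
Unset Printing Implicit Defensive.
Local Open Scope ring_scope.

(** * Algebra of the dressing *)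

Definition mx_expand := (mulmxDl, mulmxDr, mulNmx, mulmxN, mulmxA).


(** Unlike [mxE], these rules leave matrix products unopened. *)
Lemma mx_entryD (K : comPzRingType) a b (A B : 'M[K]_(a, b)) i j :
  (A + B) i j = A i j + B i j.
Proof. exact: mxE. Qed.
Lemma mx_entryN (K : comPzRingType) a b (A : 'M[K]_(a, b)) i j : (- A) i j = - A i j.
Proof. exact: mxE. Qed.
Lemma mx_entryZ (K : comPzRingType) a b (c : K) (A : 'M[K]_(a, b)) i j :
  (c *: A) i j = c * A i j.
Proof. exact: mxE. Qed.

(** Treats every matrix product as an atom, so products must first be expanded and associated to the
    left; what remains is linear over the entries. *)
Ltac mx_linear :=
  apply/matrixP => ? ?; rewrite !(mx_entryD, mx_entryN, mx_entryZ);
  repeat match goal with |- context [fun_of_matrix ?A ?i ?j] =>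
    move: (fun_of_matrix A i j) => ? end; ring.

(** Here [mu] is lambda, [om] is i Omega, [h] is one half and [k] is the lambda-free part of the
    t-matrix. No adjoint occurs: [Z] and [L'] are tied to [Y] and [L] only through [mL]. *)
Section DressingAlgebra.
Variables (K : comUnitRingType) (d n r : nat).
Variables (s u ux k : 'M[K]_d) (Y : 'M[K]_(d, n)) (Z : 'M[K]_(n, d)).
Variables (L L' m w : 'M[K]_n) (mu h : K).
Variables (phi : 'M[K]_(d, r)) (om : 'M[K]_(n, r)).
Hypotheses (mw : m *m w = 1%:M) (wm : w *m m = 1%:M).
Hypothesis (mL : m *m L - L' *m m = Z *m Y).
Hypothesis (Lom : mu *: om - L' *m om = Z *m phi).

Let p := Y *m w *m Z.
Let D := s *m p - p *m s.
Let phin := phi - Y *m w *m om.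

(** Multiply [mL] by [w] on both sides. *)
Lemma spectral_winv : L *m w = w *m L' + w *m Z *m Y *m w.
Proof.
rewrite -[w *m Z *m Y]mulmxA -mL mulmxBr mulmxBl !mulmxA wm mul1mx.
by rewrite -[_ *m m *m w]mulmxA mw mulmx1 addrC subrK.
Qed.

(** Trades [L] acting on the coefficients [w om] for the scalar [mu], at the price of a term in the
    dressed vector [phin]. *)
Lemma spectral_coord : L *m w *m om = mu *: (w *m om) - w *m Z *m phin.
Proof.
have -> : w *m Z *m phin = w *m (Z *m phi) - w *m Z *m Y *m w *m om.
  by rewrite /phin mulmxBr !mulmxA.
rewrite -Lom spectral_winv mulmxDl mulmxBr -scalemxAr !mulmxA.
by mx_linear.
Qed.

(** The left side is the product rule for [phin]. Removing [L] by [spectral_coord] produces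
    [s p phin], and the derivatives of [w] and [om] combine to [- p s phin]; together they give
    [D phin]. *)
Lemma dressing_x :
  (mu *: s + u) *m phi - ((s *m Y *m L + u *m Y) *m w *m om
     - Y *m w *m (Z *m s *m Y) *m w *m om + Y *m w *m (Z *m s *m phi)) =
  (mu *: s + (u + D)) *m phin.
Proof.
have -> : (s *m Y *m L + u *m Y) *m w *m om = s *m Y *m (L *m w *m om) + u *m Y *m w *m om.
  by rewrite !mx_expand.
rewrite spectral_coord /D /p.
have -> : Y *m w *m (Z *m s *m phi) = Y *m w *m Z *m s *m phin + Y *m w *m (Z *m s *m Y) *m w *m om.
  by rewrite /phin !mx_expand subrK.
rewrite mulmxBr -scalemxAr !mulmxA.
rewrite (_ : phi = phin + Y *m w *m om); last by rewrite subrK.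
move: (phin) => f; rewrite !(mx_expand, =^~ scalemxAl, =^~ scalemxAr).
mx_linear.
Qed.

(* The product rule for p = Y w Z, with Y_x = s Y L + u Y and m_x = Z s Y. *)
Definition dressed_deriv := (s *m Y *m L + u *m Y) *m w *m Z
  - Y *m w *m (Z *m s *m Y) *m w *m Z - Y *m w *m (L' *m Z *m s + Z *m u).
Let E := dressed_deriv.
Let p1 := Y *m L *m w *m Z.

(** Eliminating [L'] leaves a polynomial in [s], [u], [p] and [p1], where [p1] enters only through
    its commutator with [s]. *)
Lemma dressed_derivE :
  E = s *m p1 + u *m p - p *m s *m p - p1 *m s + p *m p *m s - p *m u.
Proof.
have wL' : w *m L' = L *m w - w *m Z *m Y *m w by rewrite spectral_winv addrK.
have -> : E = s *m p1 + u *m p - p *m s *m p - Y *m (w *m L') *m Z *m s - p *m u.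
  by rewrite /E /dressed_deriv /p1 /p !mx_expand opprD !addrA.
rewrite wL' /p1 /p !(mulmxBr, mulmxBl) !mulmxA.
by mx_linear.
Qed.

(** As for x, but [L] now occurs squared, so [spectral_coord] is used twice. The leftover that is
    not [mu D] is exactly [E]. *)
Lemma dressing_t :
  (mu ^+ 2 *: s + mu *: u + k) *m phi
    - ((s *m Y *m L *m L + u *m Y *m L + k *m Y) *m w *m om
       - Y *m w *m (Z *m s *m Y *m L + L' *m Z *m s *m Y + Z *m u *m Y) *m w *m om
       + Y *m w *m (mu *: (Z *m s *m phi) + L' *m Z *m s *m phi + Z *m u *m phi)) =
  (mu ^+ 2 *: s + mu *: (u + D) + (k + E)) *m phin.
Proof.
have LLw : L *m (L *m w *m om) =
    mu ^+ 2 *: (w *m om) - mu *: (w *m Z *m phin) - L *m w *m Z *m phin.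
  rewrite {1}spectral_coord mulmxBr -scalemxAr !mulmxA spectral_coord.
  by rewrite scalerBr scalerA.
have wL' : Y *m w *m L' = Y *m L *m w - Y *m w *m Z *m Y *m w.
  rewrite -2!mulmxA (_ : w *m L' = L *m w - w *m Z *m Y *m w) ?mulmxBr ?mulmxA //.
  by rewrite spectral_winv addrK.
rewrite dressed_derivE /D /p1 /p.
have -> : (s *m Y *m L *m L + u *m Y *m L + k *m Y) *m w *m om =
    s *m Y *m (L *m (L *m w *m om)) + u *m Y *m (L *m w *m om) + k *m Y *m w *m om.
  by rewrite !mx_expand.
have -> : Y *m w *m (Z *m s *m Y *m L + L' *m Z *m s *m Y + Z *m u *m Y) *m w *m om =
    Y *m w *m Z *m s *m Y *m (L *m w *m om) +
    Y *m w *m L' *m Z *m s *m Y *m w *m om + Y *m w *m Z *m u *m Y *m w *m om.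
  by rewrite !mx_expand.
rewrite LLw spectral_coord !mulmxDr -!scalemxAr !mulmxA wL'.
rewrite (_ : phi = phin + Y *m w *m om); last by rewrite subrK.
move: (phin) => f.
rewrite !(mx_expand, =^~ scalemxAl, =^~ scalemxAr).
by mx_linear.
Qed.

(** Since s [s, E] = -E - s E s, the correction to [k] on the right is [h] times (E - s E s) + (E +
    s E s), that is 2h E = E. *)
Lemma dressing_potential :
  s *m s = - 1%:M -> u *m s = - (s *m u) -> h + h = 1 ->
  k = h *: (s *m (u *m u - ux)) ->
  k + E = h *: (s *m ((u + D) *m (u + D) - (ux + (s *m E - E *m s)))).
Proof.
move=> ss us h2 ->.
have ssA q (A : 'M_(q, d)) : A *m s *m s = - A by rewrite -mulmxA ss mulmxN mulmx1.
have usA q (A : 'M_(q, d)) : A *m u *m s = - (A *m s *m u).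
  by rewrite -mulmxA us mulmxN mulmxA.
(* The map X -> X - s X s kills [s, p1] because s^2 = -1, so only [p] and [u] survive. The rewrite
   rules bring words to a normal form with [s] to the left of [u]. *)
have key : E - s *m E *m s = s *m (u *m D + D *m u + D *m D).
  rewrite dressed_derivE /D; move: (p) (p1) => P P1.
  rewrite !(mx_expand, ss, ssA, us, usA, mul1mx).
  by mx_linear.
have E2 : E = h *: (E + E) by rewrite scalerDr -scalerDl h2 scale1r.
have -> : s *m ((u + D) *m (u + D) - (ux + (s *m E - E *m s))) =
    s *m (u *m u - ux) + s *m (u *m D + D *m u + D *m D) - (s *m s *m E - s *m E *m s).
  by rewrite !mx_expand; mx_linear.
rewrite -key ss mulNmx mul1mx {1}E2.
by mx_linear.
Qed.
End DressingAlgebra.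

(** * Matrix calculus over the complex numbers *)

Definition Cplx_pair (z : Cplx) : R * R := (Re z, Im z).
Lemma Cplx_pairK : cancel Cplx_pair (fun p => mkC p.1 p.2).
Proof. by case. Qed.

HB.instance Definition _ := Choice.copy Cplx (can_type Cplx_pairK).
HB.instance Definition _ :=
  GRing.isZmodule.Build Cplx Cadd_assoc Cadd_comm Cadd_0_l Cadd_opp_l.
HB.instance Definition _ := GRing.Zmodule_isComNzRing.Build Cplx
  Cmul_assoc Cmul_comm Cmul_1_l Cmul_add_l (introN eqP C1_neq_0).
HB.instance Definition _ := GRing.ComNzRing_isField.Build Cplx
  (fun a a0 => Cmul_inv_l a (elimN eqP a0)) Cinv_0.

Lemma Cconj_zmod_morphism : zmod_morphism Cconj.
Proof. by move=> a b; rewrite [LHS]Cconj_add Cconj_opp. Qed.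
HB.instance Definition _ := GRing.isZmodMorphism.Build Cplx Cplx Cconj Cconj_zmod_morphism.
HB.instance Definition _ := GRing.isMonoidMorphism.Build Cplx Cplx Cconj
  (Cconj_1, Cconj_mul).

Definition ex_dC (f : R -> Cplx) (x : R) : Prop := exists l, is_dC f x l.

Lemma ex_dC_sum (I : Type) (e : seq I) (f : I -> R -> Cplx) x :
  (forall i, ex_dC (f i) x) -> ex_dC (fun y => \sum_(i <- e) f i y) x.
Proof.
move=> Df; elim: e => [|i e [l IH]].
  by exists 0; apply: is_dC_ext (is_dC_const 0 x) => y; rewrite big_nil.
have [l' Dl'] := Df i; exists (l' + l).
by apply: is_dC_ext (is_dC_add _ _ _ _ _ Dl' IH) => y; rewrite big_cons.
Qed.

Lemma ex_dC_prod (I : Type) (e : seq I) (f : I -> R -> Cplx) x :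
  (forall i, ex_dC (f i) x) -> ex_dC (fun y => \prod_(i <- e) f i y) x.
Proof.
move=> Df; elim: e => [|i e [l IH]].
  by exists 0; apply: is_dC_ext (is_dC_const 1 x) => y; rewrite big_nil.
have [l' Dl'] := Df i; eexists.
by apply: is_dC_ext (is_dC_mul _ _ _ _ _ Dl' IH) => y; rewrite big_cons.
Qed.

Lemma is_dC_scale (c : Cplx) f x l : is_dC f x l -> is_dC (fun y => c * f y) x (c * l).
Proof.
by move=> Df; rewrite -[c * l]add0r -[0](mul0r (f x)); apply: is_dC_mul Df; apply: is_dC_const.
Qed.

Lemma is_dC_sum (I : Type) (e : seq I) (f : I -> R -> Cplx) (l : I -> Cplx) x :
  (forall i, is_dC (f i) x (l i)) ->
  is_dC (fun y => \sum_(i <- e) f i y) x (\sum_(i <- e) l i).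
Proof.
move=> Df; elim: e => [|i e IH].
  by rewrite big_nil; apply: is_dC_ext (is_dC_const 0 x) => y; rewrite big_nil.
by rewrite big_cons; apply: is_dC_ext (is_dC_add _ _ _ _ _ (Df i) IH) => y; rewrite big_cons.
Qed.

(** Entries of [m] and [om] are controlled after multiplication by a spectral difference [c]; the
    derivative of the pairing carries the same factor. *)
Lemma is_dC_scale_cancel (c : Cplx) f g x l : c != 0 ->
  (forall y, c * f y = g y) -> is_dC g x (c * l) -> is_dC f x l.
Proof.
move=> c0 fg Dg; rewrite -[l](mulKf c0).
by apply: is_dC_ext (is_dC_scale c^-1 Dg) => y; rewrite -fg mulKf.
Qed.

Definition is_dM a b (F : R -> 'M[Cplx]_(a, b)) (x : R) (l : 'M[Cplx]_(a, b)) : Prop :=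
  forall i j, is_dC (fun y => F y i j) x (l i j).

Section MatrixCalculus.
Variables (x : R).

Lemma is_dM_ext a b (F G : R -> 'M[Cplx]_(a, b)) l :
  (forall y, F y = G y) -> is_dM F x l -> is_dM G x l.
Proof. by move=> FG DF i j; apply: is_dC_ext (DF i j) => y; rewrite FG. Qed.

Lemma is_dM_unique a b (F : R -> 'M[Cplx]_(a, b)) l l' :
  is_dM F x l -> is_dM F x l' -> l = l'.
Proof. by move=> D D'; apply/matrixP => i j; apply: is_dC_unique (D i j) (D' i j). Qed.

Lemma is_dM_const a b (A : 'M[Cplx]_(a, b)) : is_dM (fun=> A) x 0.
Proof. by move=> i j; rewrite mxE; apply: is_dC_const. Qed.

Lemma is_dM_add a b (F G : R -> 'M[Cplx]_(a, b)) l l' :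
  is_dM F x l -> is_dM G x l' -> is_dM (fun y => F y + G y) x (l + l').
Proof.
move=> D D' i j; rewrite mxE.
by apply: is_dC_ext (is_dC_add _ _ _ _ _ (D i j) (D' i j)) => y; rewrite mxE.
Qed.

Lemma is_dM_opp a b (F : R -> 'M[Cplx]_(a, b)) l :
  is_dM F x l -> is_dM (fun y => - F y) x (- l).
Proof.
move=> D i j; rewrite mxE.
by apply: is_dC_ext (is_dC_opp _ _ _ (D i j)) => y; rewrite mxE.
Qed.

Lemma is_dM_scale a b (c : Cplx) (F : R -> 'M[Cplx]_(a, b)) l :
  is_dM F x l -> is_dM (fun y => c *: F y) x (c *: l).
Proof.
move=> D i j; rewrite mxE.
by apply: is_dC_ext (is_dC_scale c (D i j)) => y; rewrite mxE.
Qed.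

Lemma is_dM_mul a b c (F : R -> 'M[Cplx]_(a, b)) (G : R -> 'M[Cplx]_(b, c)) l l' :
  is_dM F x l -> is_dM G x l' ->
  is_dM (fun y => F y *m G y) x (l *m G x + F x *m l').
Proof.
move=> D D' i j; rewrite !mxE -big_split /=.
have DD o := is_dC_mul _ _ _ _ _ (D i o) (D' o j).
by apply: is_dC_ext (is_dC_sum _ DD) => y; rewrite mxE.
Qed.

Lemma is_dM_mull a b c (A : 'M[Cplx]_(a, b)) (G : R -> 'M[Cplx]_(b, c)) l :
  is_dM G x l -> is_dM (fun y => A *m G y) x (A *m l).
Proof.
by move=> D; rewrite -[A *m l]add0r -(mul0mx _ (G x)); apply: is_dM_mul D; apply: is_dM_const.
Qed.

Lemma is_dM_mulr a b c (A : 'M[Cplx]_(b, c)) (F : R -> 'M[Cplx]_(a, b)) l :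
  is_dM F x l -> is_dM (fun y => F y *m A) x (l *m A).
Proof.
move=> D; rewrite -[l *m A]addr0 -[0](mulmx0 c (F x)).
by apply: is_dM_mul D _; apply: is_dM_const.
Qed.

Definition adjmx a b (A : 'M[Cplx]_(a, b)) : 'M_(b, a) := (map_mx Cconj A)^T.

Lemma is_dM_adj a b (F : R -> 'M[Cplx]_(a, b)) l :
  is_dM F x l -> is_dM (fun y => adjmx (F y)) x (adjmx l).
Proof.
move=> D i j; rewrite !mxE.
by apply: is_dC_ext (is_dC_conj _ _ _ (D j i)) => y; rewrite !mxE.
Qed.

Lemma ex_dC_det n (F : R -> 'M[Cplx]_n) :
  (forall i j, ex_dC (fun y => F y i j) x) -> ex_dC (fun y => \det (F y)) x.
Proof.
(* Leibniz formula: a determinant is a finite sum of signed products of entries. *)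
move=> DF; apply: ex_dC_sum => s.
have [l Dl] : ex_dC (fun y => \prod_i F y i ((s : {perm _}) i)) x by apply: ex_dC_prod => i.
by exists ((-1) ^+ s * l); apply: is_dC_scale.
Qed.

(* Cramer's rule makes the entries of the inverse rational in those of [F]. *)
Lemma ex_dM_inv n (F G : R -> 'M[Cplx]_n) l :
  is_dM F x l -> (forall y, F y *m G y = 1%:M) -> exists l', is_dM G x l'.
Proof.
move=> DF FG.
have DG i j : ex_dC (fun y => G y i j) x.
  have [c Dc] : ex_dC (fun y => cofactor (F y) j i) x.
    have [|c Dc] := @ex_dC_det _ (fun y => row' j (col' i (F y))).
      move=> i' j'; exists (l (lift j i') (lift i j')).
      by apply: is_dC_ext (DF _ _) => y; rewrite !mxE.
    by exists ((-1) ^+ (j + i) * c); apply: is_dC_scale.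
  have [e De] : ex_dC (fun y => \det (F y)) x.
    by apply: ex_dC_det => i' j'; exists (l i' j').
  have [e' De'] : ex_dC (fun y => (\det (F y))^-1) x.
    apply: ex_is_dC_inv De _ => d0.
    by have /eqP := det1 Cplx n; rewrite -(FG x) det_mulmx d0 mul0r eq_sym oner_eq0.
  eexists; apply: is_dC_ext (is_dC_mul _ _ _ _ _ De' Dc) => y.
  have [uF _] := mulmx1_unit (FG y).
  have -> : G y = invmx (F y) by rewrite -[LHS](mulKmx uF) FG mulmx1.
  by rewrite /invmx uF !mxE.
(* Finite choice collects the entrywise derivatives into one matrix. *)
have [l' Dl'] := fin_all_exists (fun i => fin_all_exists (DG i)).
by exists (\matrix_(i, j) l' i j) => i j; rewrite mxE.
Qed.

(** With differentiability of [G] known, 0 = F' G + F G' is multiplied by [G] on the left. *)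
Lemma is_dM_inv n (F G : R -> 'M[Cplx]_n) l :
  is_dM F x l -> (forall y, F y *m G y = 1%:M) -> is_dM G x (- (G x *m l *m G x)).
Proof.
move=> DF FG; have [l' DG] := ex_dM_inv DF FG.
have D1 : is_dM (fun y => F y *m G y) x 0.
  by apply: is_dM_ext (is_dM_const 1%:M) => y; rewrite FG.
have /(congr1 (mulmx (G x))) := is_dM_unique D1 (is_dM_mul DF DG).
rewrite mulmx0 mulmxDr !mulmxA (mulmx1C (FG x)) mul1mx => /esym/eqP.
by rewrite addrC addr_eq0 => /eqP <-.
Qed.
End MatrixCalculus.

(** * Dressing of a Lax solution *)

Lemma adjmxM a b c (A : 'M[Cplx]_(a, b)) (B : 'M_(b, c)) :
  adjmx (A *m B) = adjmx B *m adjmx A.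
Proof. by rewrite /adjmx map_mxM trmx_mul. Qed.
Lemma adjmxD a b (A B : 'M[Cplx]_(a, b)) : adjmx (A + B) = adjmx A + adjmx B.
Proof. by apply/matrixP => i j; rewrite !mxE rmorphD. Qed.
Lemma adjmxN a b (A : 'M[Cplx]_(a, b)) : adjmx (- A) = - adjmx A.
Proof. by apply/matrixP => i j; rewrite !mxE rmorphN. Qed.
Lemma adjmxZ a b c (A : 'M[Cplx]_(a, b)) : adjmx (c *: A) = Cconj c *: adjmx A.
Proof. by apply/matrixP => i j; rewrite !mxE rmorphM. Qed.
Lemma adjmx_diag n (l : 'rV[Cplx]_n) : adjmx (diag_mx l) = diag_mx (map_mx Cconj l).
Proof. by rewrite /adjmx map_diag_mx tr_diag_mx. Qed.

(** Each column of [Y] and [V] has its own spectral parameter, which acts by a diagonal matrix on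
    the right. The hypotheses say that [s], [u], [k] are skew for [Lm]. *)
Section LaxPairing.
Variables (d n r : nat) (s Lm : 'M[Cplx]_d) (x : R).
Variables (Y : R -> 'M[Cplx]_(d, n)) (V : R -> 'M[Cplx]_(d, r)).
Variables (u k : 'M[Cplx]_d) (l : 'rV[Cplx]_n) (lV : 'rV[Cplx]_r).
Hypotheses (adj_s : adjmx s *m Lm = - (Lm *m s)).
Hypotheses (adj_u : adjmx u *m Lm = - (Lm *m u)).
Hypotheses (adj_k : adjmx k *m Lm = - (Lm *m k)).

Let Z y := adjmx (Y y) *m Lm.
Let L := diag_mx l.
Let L' := diag_mx (map_mx Cconj l).
Let LV := diag_mx lV.

Let adjE q (A B : 'M[Cplx]_d) (C : 'M[Cplx]_(q, d)) :
  adjmx A *m Lm = - (Lm *m B) -> C *m adjmx A *m Lm = - (C *m Lm *m B).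
Proof. by move=> AB; rewrite -!mulmxA AB mulmxN. Qed.

(** Skewness moves [Lm] past the adjoints of [s] and [u], so [Z] solves the dual system with
    conjugate parameters on the left. *)
Lemma dual_lax_x : is_dM Y x (s *m Y x *m L + u *m Y x) ->
  is_dM Z x (- (L' *m Z x *m s + Z x *m u)).
Proof.
move=> /is_dM_adj/(@is_dM_mulr _ _ _ _ Lm); congr (is_dM _ _ _).
rewrite /Z adjmxD !adjmxM adjmx_diag mulmxDl !mulmxA.
by rewrite (adjE _ adj_s) (adjE _ adj_u) opprD.
Qed.

Lemma dual_lax_t : is_dM Y x (s *m Y x *m L *m L + u *m Y x *m L + k *m Y x) ->
  is_dM Z x (- (L' *m L' *m Z x *m s + L' *m Z x *m u + Z x *m k)).
Proof.
move=> /is_dM_adj/(@is_dM_mulr _ _ _ _ Lm); congr (is_dM _ _ _).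
rewrite /Z !adjmxD !adjmxM adjmx_diag !mulmxDl !mulmxA.
by rewrite (adjE _ adj_s) (adjE _ adj_u) (adjE _ adj_k) !opprD.
Qed.

(** The [u] terms cancel between [Z] and [V]; the [s] terms carry the difference of parameters that
    is the denominator in M and Omega. *)
Lemma pairing_x i j : is_dM Y x (s *m Y x *m L + u *m Y x) ->
  is_dM V x (s *m V x *m LV + u *m V x) ->
  is_dC (fun y => (Z y *m V y) i j) x
    ((lV 0 j - Cconj (l 0 i)) * (Z x *m s *m V x) i j).
Proof.
move=> /dual_lax_x DZ DV; move: (is_dM_mul DZ DV i j).
congr (is_dC _ _ _).
transitivity ((Z x *m s *m V x *m LV - L' *m (Z x *m s *m V x)) i j).
  congr (fun_of_matrix _ i j); rewrite !mx_expand.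
  by mx_linear.
rewrite mul_mx_diag mul_diag_mx ![in LHS]mxE.
by rewrite mulrBl [_ * lV _ _]mulrC; congr (_ - _ * _); rewrite !mxE.
Qed.

Lemma pairing_t i j : is_dM Y x (s *m Y x *m L *m L + u *m Y x *m L + k *m Y x) ->
  is_dM V x (s *m V x *m LV *m LV + u *m V x *m LV + k *m V x) ->
  is_dC (fun y => (Z y *m V y) i j) x
    ((lV 0 j - Cconj (l 0 i)) *
     (Z x *m s *m V x *m LV + L' *m Z x *m s *m V x + Z x *m u *m V x) i j).
Proof.
move=> /dual_lax_t DZ DV; move: (is_dM_mul DZ DV i j).
congr (is_dC _ _ _).
have eZ (A : 'M[Cplx]_(n, r)) a b : (A *m LV) a b = A a b * lV 0 b.
  by rewrite mul_mx_diag [LHS]mxE.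
have eL (A : 'M[Cplx]_(n, r)) a b : (L' *m A) a b = Cconj (l 0 a) * A a b.
  by rewrite mul_diag_mx !mxE.
(* The [k] terms cancel, and the squared parameters are arranged as a difference of squares so that
   the common factor appears. *)
have -> : - (L' *m L' *m Z x *m s + L' *m Z x *m u + Z x *m k) *m V x +
    Z x *m (s *m V x *m LV *m LV + u *m V x *m LV + k *m V x) =
  (Z x *m s *m V x *m LV - L' *m (Z x *m s *m V x)) *m LV
  + L' *m (Z x *m s *m V x *m LV - L' *m (Z x *m s *m V x))
  + (Z x *m u *m V x *m LV - L' *m (Z x *m u *m V x)).
  rewrite !mx_expand.
  by mx_linear.
rewrite -[L' *m Z x *m s *m V x]mulmxA -[L' *m Z x *m (_ *m _)]mulmxA [Z x *m (s *m _)]mulmxA.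
move: (Z x *m s *m V x) (Z x *m u *m V x) => A B.
rewrite !(mx_entryD, mx_entryN, eZ, eL).
by ring.
Qed.
End LaxPairing.

(** The running variable [x] stands for space or time, the other one being frozen. The inverse
    relation is asked along the whole line because it is differentiated, the spectral relations at
    the point. *)
Section Dressing.
Variables (d n r : nat) (s Lm : 'M[Cplx]_d) (x : R).
Variables (Y : R -> 'M[Cplx]_(d, n)) (m w : R -> 'M[Cplx]_n).
Variables (phi : R -> 'M[Cplx]_(d, r)) (om : R -> 'M[Cplx]_(n, r)).
Variables (u k : 'M[Cplx]_d) (l : 'rV[Cplx]_n) (mu : Cplx).
Hypotheses (adj_s : adjmx s *m Lm = - (Lm *m s)).
Hypotheses (adj_u : adjmx u *m Lm = - (Lm *m u)).
Let Z y := adjmx (Y y) *m Lm.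
Let L := diag_mx l.
Let L' := diag_mx (map_mx Cconj l).
Hypotheses (mw : forall y, m y *m w y = 1%:M).
Hypothesis (mL : m x *m L - L' *m m x = Z x *m Y x).
Hypothesis (Lom : mu *: om x - L' *m om x = Z x *m phi x).

Let p y := Y y *m w y *m Z y.
Let phin y := phi y - Y y *m w y *m om y.
Let D := s *m p x - p x *m s.
Let E := dressed_deriv s u (Y x) (Z x) L L' (w x).

Lemma is_dM_dressed Y' m' om' phi' :
  is_dM Y x Y' -> is_dM m x m' -> is_dM om x om' -> is_dM phi x phi' ->
  is_dM phin x (phi' - (Y' *m w x *m om x - Y x *m w x *m m' *m w x *m om x
                        + Y x *m w x *m om')).
Proof.
move=> DY Dm Dom Dphi; have Dw := is_dM_inv Dm mw.
have := is_dM_add Dphi (is_dM_opp (is_dM_mul (is_dM_mul DY Dw) Dom)).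
by congr (is_dM _ _ (_ - _)); rewrite !mx_expand.
Qed.

Lemma dressed_lax_x :
  is_dM Y x (s *m Y x *m L + u *m Y x) -> is_dM m x (Z x *m s *m Y x) ->
  is_dM om x (Z x *m s *m phi x) -> is_dM phi x ((mu *: s + u) *m phi x) ->
  is_dM phin x ((mu *: s + (u + D)) *m phin x).
Proof.
move=> DY Dm Dom Dphi; have := is_dM_dressed DY Dm Dom Dphi.
by rewrite (dressing_x s u (mw x) (mulmx1C (mw x)) mL Lom).
Qed.

Lemma dressed_potential_x :
  is_dM Y x (s *m Y x *m L + u *m Y x) -> is_dM m x (Z x *m s *m Y x) ->
  is_dM p x E.
Proof.
move=> DY Dm; have DZ := dual_lax_x adj_s adj_u DY; have Dw := is_dM_inv Dm mw.
have := is_dM_mul (is_dM_mul DY Dw) DZ.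
by congr (is_dM _ _ _); rewrite /E /dressed_deriv !mx_expand.
Qed.

Lemma dressed_lax_t :
  is_dM Y x (s *m Y x *m L *m L + u *m Y x *m L + k *m Y x) ->
  is_dM m x (Z x *m s *m Y x *m L + L' *m Z x *m s *m Y x + Z x *m u *m Y x) ->
  is_dM om x (mu *: (Z x *m s *m phi x) + L' *m Z x *m s *m phi x + Z x *m u *m phi x) ->
  is_dM phi x ((mu ^+ 2 *: s + mu *: u + k) *m phi x) ->
  is_dM phin x ((mu ^+ 2 *: s + mu *: (u + D) + (k + E)) *m phin x).
Proof.
move=> DY Dm Dom Dphi; have := is_dM_dressed DY Dm Dom Dphi.
by rewrite (dressing_t s u k (mw x) (mulmx1C (mw x)) mL Lom).
Qed.
End Dressing.

(** * Matrices of the statement *)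

Lemma Csum_big n f : Csum n f = \sum_(i < n) f i.
Proof. by elim: n => [|n IH] /=; rewrite ?big_ord0 // big_ord_recr -IH. Qed.

Definition mx a b (A : mat) : 'M[Cplx]_(a, b) := \matrix_(i, j) A i j.
(** A single vector is a constant family with one column, so that results about Y also serve Phi. *)
Definition cols d n (F : nat -> vec) : 'M[Cplx]_(d, n) := mx d n (fun a j => F j a).

Lemma mx_mul a b c (A B : mat) : mx a c (mmul b A B) = mx a b A *m mx b c B.
Proof.
apply/matrixP => i j; rewrite !mxE [LHS]Csum_big.
by apply: eq_bigr => o _; rewrite !mxE.
Qed.

Lemma cols_mul a b c (A : mat) (F : nat -> vec) :
  mx a b A *m cols b c F = cols a c (fun j => mvmul b A (F j)).
Proof.
apply/matrixP => i j; rewrite !mxE [RHS]Csum_big.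
by apply: eq_bigr => o _; rewrite !mxE.
Qed.

Lemma cdot_cols d a b (F G : nat -> vec) i j :
  (adjmx (cols d a F) *m cols d b G) i j = cdot d (F i) (G j).
Proof.
rewrite mxE [RHS]Csum_big; apply: eq_bigr => o _; by rewrite !mxE.
Qed.

Lemma mx_add a b A B : mx a b (madd A B) = mx a b A + mx a b B.
Proof. by apply/matrixP => i j; rewrite !mxE. Qed.
Lemma mx_sub a b A B : mx a b (msub A B) = mx a b A - mx a b B.
Proof. by apply/matrixP => i j; rewrite !mxE. Qed.
Lemma mx_scale a b c A : mx a b (mscale c A) = c *: mx a b A.
Proof. by apply/matrixP => i j; rewrite !mxE. Qed.
Lemma mx_adj a b A : mx a b (madj A) = adjmx (mx b a A).
Proof. by apply/matrixP => i j; rewrite !mxE. Qed.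
Lemma mx_comm d A B :
  mx d d (comm d A B) = mx d d A *m mx d d B - mx d d B *m mx d d A.
Proof. by rewrite mx_sub !mx_mul. Qed.

Lemma CmulE a b : Cmul a b = a * b. Proof. by []. Qed.
Lemma CiCi : Ci * Ci = -1. Proof. exact: Ci_mul. Qed.

Definition isigma d : 'M[Cplx]_d := Ci *: mx d d sigma3.

Lemma mx_Umat d lam Q : mx d d (Umat lam Q) = lam *: isigma d + Ci *: mx d d Q.
Proof. by rewrite mx_add !mx_scale scalerA [lam * _]mulrC. Qed.

(* With u = iQ this is the lambda-free part -(i sigma3 Q^2 - sigma3 Q_x)/2 of the
   t-equation. *)
Definition dispersion d (u ux : 'M[Cplx]_d) := Chalf *: (isigma d *m (u *m u - ux)).

(** With s = i sigma_3 and u = iQ, s u^2 = -i sigma_3 Q^2 and s u_x = -sigma_3 Q_x. *)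
Lemma mx_Vmat d lam Q Qx : mx d d (Vmat d lam Q Qx) =
  lam ^+ 2 *: isigma d + lam *: (Ci *: mx d d Q) + dispersion (Ci *: mx d d Q) (Ci *: mx d d Qx).
Proof.
rewrite mx_sub mx_add !mx_scale mx_sub mx_scale !mx_mul /dispersion /isigma.
rewrite !(mulmxDl, mulmxDr, mulmxN, =^~ scalemxAl, =^~ scalemxAr, scalerN, scalerDr, scalerA).
apply/matrixP => i j; rewrite !(mx_entryD, mx_entryN, mx_entryZ) -/Chalf.
rewrite CmulE [Cmul lam _]CmulE [Cmul Ci lam]CmulE.
ring: CiCi.
Qed.

Lemma Nat_eqbE a b : Nat.eqb a b = (a == b).
Proof. by elim: a b => [|a IH] []. Qed.

Lemma mx_sigma3 d : mx d d sigma3 = diag_mx (\row_i sigma3_diag i).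
Proof.
apply/matrixP => i j; rewrite !mxE /sigma3 -/(sigma3_diag i) Nat_eqbE -val_eqE /=.
by case: eqP.
Qed.

Lemma mx_Lam d k : mx d d (Lam k) = diag_mx (\row_i Lam_diag k i).
Proof.
apply/matrixP => i j; rewrite !mxE /Lam -/(Lam_diag k i) Nat_eqbE -val_eqE /=.
by case: eqP.
Qed.

Lemma isigma_sqr d : isigma d *m isigma d = - 1%:M.
Proof.
rewrite /isigma -scalemxAl -scalemxAr scalerA CiCi scaleN1r mx_sigma3 mulmx_diag.
congr (- _); rewrite -diag_const_mx; congr diag_mx.
by apply/rowP => i; rewrite !mxE; exact: sigma3_diag_sqr.
Qed.

(** The matrix sigma_3 is real, diagonal and commutes with Lambda; the sign comes from conjugating
    i. *)
Lemma isigma_Lam d k :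
  adjmx (isigma d) *m mx d d (Lam k) = - (mx d d (Lam k) *m isigma d).
Proof.
rewrite /isigma adjmxZ Cconj_i -[Copp _]/(- Ci) -scalemxAl -scalemxAr -scaleNr.
rewrite mx_sigma3 mx_Lam adjmx_diag diag_mxC; congr (_ *: (_ *m diag_mx _)).
by apply/rowP => i; rewrite !mxE; exact: Cconj_sigma3_diag.
Qed.

Lemma Qof_isigma d k q : let u := Ci *: mx d d (Qof k q) in
  u *m isigma d = - (isigma d *m u).
Proof.
rewrite /isigma /= -!(scalemxAl, scalemxAr) -!scalerN; congr (_ *: (_ *: _)).
rewrite mx_sigma3 mul_mx_diag mul_diag_mx; apply/matrixP => i j; rewrite !mxE.
exact: Qof_sigma3.
Qed.

Lemma Qof_skew d k q : let u := Ci *: mx d d (Qof k q) in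
  adjmx u *m mx d d (Lam k) = - (mx d d (Lam k) *m u).
Proof.
rewrite /= adjmxZ Cconj_i -[Copp _]/(- Ci) -scalemxAl -scalemxAr -scaleNr.
congr (_ *: _); rewrite mx_Lam mul_mx_diag mul_diag_mx.
by apply/matrixP => i j; rewrite !mxE; exact: Qof_Lam.
Qed.

(** For the form [Lm], u^2 is self-adjoint and commutes with s, while u_x is skew and anticommutes
    with s; in both cases the product with the skew s is skew. *)
Lemma dispersion_skew d (u ux Lm : 'M[Cplx]_d) :
  adjmx (isigma d) *m Lm = - (Lm *m isigma d) ->
  adjmx u *m Lm = - (Lm *m u) -> adjmx ux *m Lm = - (Lm *m ux) ->
  u *m isigma d = - (isigma d *m u) -> ux *m isigma d = - (isigma d *m ux) ->
  adjmx (dispersion u ux) *m Lm = - (Lm *m dispersion u ux).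
Proof.
move=> hs hu hux us uxs.
rewrite /dispersion adjmxZ Cconj_half adjmxM adjmxD adjmxN adjmxM.
rewrite -scalemxAl -scalemxAr -scalerN; congr (_ *: _).
rewrite -mulmxA hs mulmxN mulmxA; congr (- _).
rewrite mulmxBl -mulmxA hu mulmxN hux mulmxA hu mulNmx !opprK.
rewrite mulmxDl -!mulmxA uxs us !mulmxN [u *m (isigma d *m u)]mulmxA us.
by rewrite mulNmx mulmxN opprK mulmxBr mulmxBr !mulmxA.
Qed.

(** * Componentwise Lax systems as matrix equations, and back *)

Section LaxSystems.
Variables (d n : nat) (Qf Qxf : R -> R -> mat).
Variables (lams : nat -> Cplx) (F : nat -> R -> R -> vec).
Let W x t := cols d n (fun j => F j x t).
Let L := diag_mx (\row_(j < n) lams j).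
Let u x t := Ci *: mx d d (Qf x t).

Let eL (A : 'M[Cplx]_(d, n)) b c : (A *m L) b c = lams c * A b c.
Proof. by rewrite mul_mx_diag !mxE mulrC. Qed.

Lemma lax_x_cols : (forall j, lt j n -> lax_x d Qf (lams j) (F j)) ->
  forall x t, is_dM (fun y => W y t) x (isigma d *m W x t *m L + u x t *m W x t).
Proof.
move=> H x t a j; have [Hr Hi] := H j (elimT ltP (ltn_ord j)) a (elimT ltP (ltn_ord a)).
have : is_dC (fun y => F j y t a) x (mvmul d (Umat (lams j) (Qf x t)) (F j x t) a).
  by split; [exact: Hr | exact: Hi].
have -> : mvmul d (Umat (lams j) (Qf x t)) (F j x t) a =
    (isigma d *m W x t *m L + u x t *m W x t) a j.
  transitivity (((lams j *: isigma d + u x t) *m W x t) a j).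
    by rewrite -mx_Umat cols_mul !mxE.
  by rewrite mulmxDl -scalemxAl !(mx_entryD, mx_entryZ, eL).
by apply: is_dC_ext => y; rewrite !mxE.
Qed.

Lemma lax_t_cols : (forall j, lt j n -> lax_t d Qf Qxf (lams j) (F j)) ->
  forall x t, is_dM (fun y => W x y) t
    (isigma d *m W x t *m L *m L + u x t *m W x t *m L
     + dispersion (u x t) (Ci *: mx d d (Qxf x t)) *m W x t).
Proof.
move=> H x t a j; have [Hr Hi] := H j (elimT ltP (ltn_ord j)) a (elimT ltP (ltn_ord a)).
set k := dispersion _ _.
have : is_dC (fun y => F j x y a) t (mvmul d (Vmat d (lams j) (Qf x t) (Qxf x t)) (F j x t) a).
  by split; [exact: Hr | exact: Hi].
have -> : mvmul d (Vmat d (lams j) (Qf x t) (Qxf x t)) (F j x t) a =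
    (isigma d *m W x t *m L *m L + u x t *m W x t *m L + k *m W x t) a j.
  transitivity (((lams j ^+ 2 *: isigma d + lams j *: u x t + k) *m W x t) a j).
    by rewrite -mx_Vmat cols_mul !mxE.
  move: (isigma d) (u x t) (k) => A B C.
  by rewrite !mulmxDl -!scalemxAl !(mx_entryD, mx_entryZ, eL) expr2 mulrA.
by apply: is_dC_ext => y; rewrite !mxE.
Qed.
End LaxSystems.

Lemma mpd_x_mx d F G : mpd_x d F G ->
  forall x t, is_dM (fun y => mx d d (F y t)) x (mx d d (G x t)).
Proof.
move=> H x t a b.
have [Hr Hi] := H a b (elimT ltP (ltn_ord a)) (elimT ltP (ltn_ord b)).
rewrite mxE; apply: (@is_dC_ext (fun y => F y t a b)) => [y|]; first by rewrite mxE.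
by split; [exact: Hr | exact: Hi].
Qed.

Lemma mx_mpd_x d F G :
  (forall x t, is_dM (fun y => mx d d (F y t)) x (mx d d (G x t))) -> mpd_x d F G.
Proof.
move=> H a b /ltP ha /ltP hb; split=> x t; have := H x t (Ordinal ha) (Ordinal hb);
  rewrite mxE => /(@is_dC_ext _ (fun y => F y t a b)) []// y; by rewrite mxE.
Qed.

Lemma cols_lax_x d Qf lam F :
  (forall x t, is_dM (fun y => cols d 1 (fun=> F y t)) x
     ((lam *: isigma d + Ci *: mx d d (Qf x t)) *m cols d 1 (fun=> F x t))) ->
  lax_x d Qf lam F.
Proof.
move=> H a /ltP ha; split=> x t; have := H x t (Ordinal ha) 0;
  rewrite -mx_Umat cols_mul mxE => /(@is_dC_ext _ (fun y => F y t a)) []// y; by rewrite mxE.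
Qed.

Lemma cols_lax_t d Qf Qxf lam F :
  (forall x t, is_dM (fun y => cols d 1 (fun=> F x y)) t
     ((lam ^+ 2 *: isigma d + lam *: (Ci *: mx d d (Qf x t))
       + dispersion (Ci *: mx d d (Qf x t)) (Ci *: mx d d (Qxf x t)))
      *m cols d 1 (fun=> F x t))) ->
  lax_t d Qf Qxf lam F.
Proof.
move=> H a /ltP ha; split=> x t; have := H x t (Ordinal ha) 0;
  rewrite -mx_Vmat cols_mul mxE => /(@is_dC_ext _ (fun y => F x y a)) []// y; by rewrite mxE.
Qed.

End DarbouxMatrices.

(** * Verification of the dressed Lax pair *)

Theorem mainTheorem3
  (N k n : nat) (HN : (1 <= N)%nat) (Hk : (k <= N)%nat) (Hn : (1 <= n)%nat)
  (q : R -> R -> vec)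
  (Hq : forall l, (1 <= l <= N)%nat -> smoothC (fun x t => q x t l))
  (Qx : R -> R -> mat)
  (HQx : mpd_x (S N) (fun x t => Qof k (q x t)) Qx)
  (lams : nat -> Cplx) (Phis : nat -> R -> R -> vec)
  (Hsol : forall j, (j < n)%nat ->
     lax_solution (S N) (fun x t => Qof k (q x t)) Qx (lams j) (Phis j))
  (Hlams : forall i j, (i < n)%nat -> (j < n)%nat -> i <> j ->
     lams j <> Cconj (lams i))
  (lam : Cplx) (Phi : R -> R -> vec)
  (HPhi : lax_solution (S N) (fun x t => Qof k (q x t)) Qx lam Phi)
  (Hlam : forall i, (i < n)%nat -> lam <> Cconj (lams i))
  (M : R -> R -> mat)
  (HMoff : forall i j, (i < n)%nat -> (j < n)%nat ->
     (i <> j \/ Im (lams i) <> 0) ->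
     forall x t, M x t i j =
       Cdiv (cdot (S N) (Phis i x t) (mvmul (S N) (Lam k) (Phis j x t)))
            (Cmul Ci (Csub (lams j) (Cconj (lams i)))))
  (Hreal0 : forall i, (i < n)%nat -> Im (lams i) = 0 ->
     forall x t, cdot (S N) (Phis i x t) (mvmul (S N) (Lam k) (Phis i x t)) = C0)
  (HMreal : forall i, (i < n)%nat -> Im (lams i) = 0 ->
     (forall x t, Im (M x t i i) = 0) /\ smoothC (fun x t => M x t i i) /\
     cpd_x (fun x t => M x t i i)
           (fun x t => omega_x (S N) k (Phis i x t) (Phis i x t)) /\
     cpd_t (fun x t => M x t i i)
           (fun x t => omega_t (S N) k (lams i) (lams i) (Qof k (q x t))
                         (Phis i x t) (Phis i x t)))
  (Minv : R -> R -> mat)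
  (HMinv : forall x t i j, (i < n)%nat -> (j < n)%nat ->
     mmul n (M x t) (Minv x t) i j = idm i j /\
     mmul n (Minv x t) (M x t) i j = idm i j) :
  let Y : R -> R -> mat := fun x t a j => Phis j x t a in
  let Om : R -> R -> vec := fun x t i =>
     Cdiv (cdot (S N) (Phis i x t) (mvmul (S N) (Lam k) (Phi x t)))
          (Cmul Ci (Csub lam (Cconj (lams i)))) in
  let Phin : R -> R -> vec := fun x t a =>
     Csub (Phi x t a) (mvmul n (mmul n (Y x t) (Minv x t)) (Om x t) a) in
  let Qn : R -> R -> mat := fun x t =>
     msub (Qof k (q x t))
       (mscale Ci (comm (S N) sigma3
          (mmul (S N) (mmul n (mmul n (Y x t) (Minv x t)) (madj (Y x t))) (Lam k)))) in
  exists Qnx : R -> R -> mat,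
    mpd_x (S N) Qn Qnx /\
    lax_x (S N) Qn lam Phin /\
    lax_t (S N) Qn Qnx lam Phin.
Proof.
(* Imported only here: the arithmetic notations of MathComp would change the
   meaning of the statement. *)
Import DarbouxMatrices.
Import all_boot all_algebra ring Rstruct.
Import GRing.Theory.
Local Open Scope ring_scope.
intros Y Om Phin Qn.
pose s := isigma N.+1.
pose Lm := mx N.+1 N.+1 (Lam k).
pose u x t := Ci *: mx N.+1 N.+1 (Qof k (q x t)).
pose ux x t := Ci *: mx N.+1 N.+1 (Qx x t).
pose kk x t := dispersion (u x t) (ux x t).
pose Ym x t := cols N.+1 n (fun j => Phis j x t).
pose Z x t := adjmx (Ym x t) *m Lm.
pose l := \row_(j < n) lams j.
pose L := diag_mx l.
pose L' := diag_mx (map_mx Cconj l).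
(* The factors i and -i keep [w] inverse to [m], and make [w om] equal to M^-1 Omega. *)
pose m x t := Ci *: mx n n (M x t).
pose w x t := - Ci *: mx n n (Minv x t).
pose ph x t := cols N.+1 1 (fun=> Phi x t).
pose om x t := Ci *: cols n 1 (fun=> Om x t).
pose P x t := Ym x t *m w x t *m Z x t.
pose Dp x t := s *m P x t - P x t *m s.
pose phn x t := ph x t - Ym x t *m w x t *m om x t.
pose E x t := dressed_deriv s (u x t) (Ym x t) (Z x t) L L' (w x t).
have us x t : u x t *m s = - (s *m u x t) by exact: Qof_isigma.
have adj_s : adjmx s *m Lm = - (Lm *m s) by exact: isigma_Lam.
have adj_u x t : adjmx (u x t) *m Lm = - (Lm *m u x t) by exact: Qof_skew.
have Dux x t : is_dM (fun y => u y t) x (ux x t).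
  by apply: is_dM_scale; exact: (mpd_x_mx HQx).
(* [Qx] is known only as a derivative of Q, so its symmetries come from differentiating those of [u]
   and uniqueness of derivatives. *)
have uxs x t : ux x t *m s = - (s *m ux x t).
  apply: is_dM_unique (is_dM_mulr s (Dux x t)) _.
  by apply: is_dM_ext (is_dM_opp (is_dM_mull s (Dux x t))) => y; rewrite us.
have adj_ux x t : adjmx (ux x t) *m Lm = - (Lm *m ux x t).
  apply: is_dM_unique (is_dM_mulr Lm (is_dM_adj (Dux x t))) _.
  by apply: is_dM_ext (is_dM_opp (is_dM_mull Lm (Dux x t))) => y; rewrite adj_u.
have adj_k x t : adjmx (kk x t) *m Lm = - (Lm *m kk x t).
  exact: dispersion_skew.
have DYx x t : is_dM (fun y => Ym y t) x (s *m Ym x t *m L + u x t *m Ym x t).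
  exact: (lax_x_cols (fun j hj => proj1 (proj2 (Hsol j hj)))).
have DYt x t : is_dM (fun y => Ym x y) t
    (s *m Ym x t *m L *m L + u x t *m Ym x t *m L + kk x t *m Ym x t).
  exact: (lax_t_cols (fun j hj => proj2 (proj2 (Hsol j hj)))).
have lE j : l 0 j = lams j by rewrite mxE.
(* Phi is treated as a one-column family, whose parameter matrix acts as the scalar [lam]. *)
pose l1 : 'rV[Cplx]_1 := \row_(j < 1) lam.
have l1E j : l1 0 j = lam by rewrite mxE.
pose L1 := diag_mx l1.
have L1E a (A : 'M[Cplx]_(a, 1)) : A *m L1 = lam *: A.
  by apply/matrixP => i j; rewrite mul_mx_diag !mxE mulrC.
have Dphx x t : is_dM (fun y => ph y t) x (s *m ph x t *m L1 + u x t *m ph x t).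
  exact: (lax_x_cols (fun j (_ : lt j 1) => proj1 (proj2 HPhi))).
have Dpht x t : is_dM (fun y => ph x y) t
    (s *m ph x t *m L1 *m L1 + u x t *m ph x t *m L1 + kk x t *m ph x t).
  exact: (lax_t_cols (fun j (_ : lt j 1) => proj2 (proj2 HPhi))).
have ZE x t r (G : nat -> vec) i j :
    (Z x t *m cols N.+1 r G) i j = cdot N.+1 (Phis i x t) (mvmul N.+1 (Lam k) (G j)).
  by rewrite /Z -mulmxA cols_mul cdot_cols.
have ltn_ltP (i : 'I_n) : lt i n := elimT ltP (ltn_ord i).
(* The i in [m] and [om] cancels the i in the denominators of M and Omega. *)
have quot (a c : Cplx) : c != 0 -> c * (Ci * Cdiv a (Cmul Ci c)) = a.
  move=> c0; have i0 : Ci != 0 by apply/eqP/Ci_neq_0.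
  by rewrite (_ : Cdiv _ _ = a / (Ci * c)) // mulrA (mulrC c) mulrCA divff ?mulr1 ?mulf_neq0.
have cij (i j : 'I_n) : (i : nat) <> j \/ Im (lams i) <> 0 -> lams j - Cconj (lams i) != 0.
  move=> ij; apply/eqP => /subr0_eq; case: (eqVneq i j) ij => [<- [//|/Cconj_neq //]|/eqP ij _].
  by apply: Hlams => // /val_inj.
have real_diag (i j : 'I_n) :
    ~ ((i : nat) <> j \/ Im (lams i) <> 0) -> j = i /\ Im (lams i) = 0.
  move=> ij; split; first by apply/val_inj/eqP; apply: contraT => /eqP ji; case: ij; left=> /esym.
  by case: (Req_dec (Im (lams i)) 0) => // ?; case: ij; right.
(* In this division-free form the real diagonal entries are included: both sides are then zero. *)
have mE x t (i j : 'I_n) : (lams j - Cconj (lams i)) * m x t i j = (Z x t *m Ym x t) i j.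
  rewrite ZE !mxE; case: (classic ((i : nat) <> j \/ Im (lams i) <> 0)) => [ij|/real_diag [-> im0]].
    by rewrite HMoff //; apply/quot/cij.
  by rewrite Hreal0 // Cconj_real // subrr mul0r.
have lam0 i : lt i n -> lam - Cconj (lams i) != 0.
  by move=> /Hlam h; apply/eqP => /subr0_eq.
have omE x t (i : 'I_n) j : (lam - Cconj (lams i)) * om x t i j = (Z x t *m ph x t) i j.
  by rewrite ZE !mxE /Om; apply/quot/lam0/ltn_ltP.
have mw x t : m x t *m w x t = 1%:M.
  rewrite /m /w -scalemxAl -scalemxAr scalerA mulrN CiCi opprK scale1r -mx_mul.
  apply/matrixP => i j; rewrite !mxE; have [-> _] := HMinv x t i j (ltn_ltP i) (ltn_ltP j).
  by rewrite /idm Nat_eqbE -val_eqE /=; case: eqP.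
have eL (i : 'I_n) r (A : 'M[Cplx]_(n, r)) j : (L' *m A) i j = Cconj (lams i) * A i j.
  by rewrite mul_diag_mx !mxE.
have eR (j : 'I_n) r (A : 'M[Cplx]_(r, n)) i : (A *m L) i j = lams j * A i j.
  by rewrite mul_mx_diag !mxE mulrC.
have mL x t : m x t *m L - L' *m m x t = Z x t *m Ym x t.
  by apply/matrixP => i j; rewrite -mE mulrBl mx_entryD mx_entryN eL eR.
have Lom x t : lam *: om x t - L' *m om x t = Z x t *m ph x t.
  by apply/matrixP => i j; rewrite -omE mulrBl mx_entryD mx_entryN eL mx_entryZ.
have Domx x t : is_dM (fun y => om y t) x (Z x t *m s *m ph x t).
  move=> i j; apply: (is_dC_scale_cancel (lam0 _ (ltn_ltP i)) (fun y => omE y t i j)).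
  by have := pairing_x adj_s (adj_u x t) i j (DYx x t) (Dphx x t); rewrite ?l1E !lE.
have Domt x t : is_dM (fun y => om x y) t
    (lam *: (Z x t *m s *m ph x t) + L' *m Z x t *m s *m ph x t + Z x t *m u x t *m ph x t).
  move=> i j; apply: (is_dC_scale_cancel (lam0 _ (ltn_ltP i)) (fun y => omE x y i j)).
  by have := pairing_t adj_s (adj_u x t) (adj_k x t) i j (DYt x t) (Dpht x t); rewrite ?l1E !lE L1E.
have Dmx x t : is_dM (fun y => m y t) x (Z x t *m s *m Ym x t).
  move=> i j; case: (classic ((i : nat) <> j \/ Im (lams i) <> 0)) => [ij|/real_diag [-> im0]].
    apply: (is_dC_scale_cancel (cij _ _ ij) (fun y => mE y t i j)).
    by have := pairing_x adj_s (adj_u x t) i j (DYx x t) (DYx x t); rewrite ?l1E !lE.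
  (* At a real parameter the spectral factor vanishes, and the derivative comes from dM_ii = omega
     instead. *)
  have [_ [_ [[Hr Hi] _]]] := HMreal i (ltn_ltP i) im0.
  have -> : (Z x t *m s *m Ym x t) i i = Ci * omega_x N.+1 k (Phis i x t) (Phis i x t).
    by rewrite -mulmxA /s /isigma -scalemxAl -scalemxAr mx_entryZ cols_mul ZE.
  have := is_dC_scale Ci (conj (Hr x t) (Hi x t)).
  by apply: is_dC_ext => y; rewrite mxE [mx _ _ _ _ _]mxE.
have Dmt x t : is_dM (fun y => m x y) t
    (Z x t *m s *m Ym x t *m L + L' *m Z x t *m s *m Ym x t + Z x t *m u x t *m Ym x t).
  move=> i j; case: (classic ((i : nat) <> j \/ Im (lams i) <> 0)) => [ij|/real_diag [-> im0]].
    apply: (is_dC_scale_cancel (cij _ _ ij) (fun y => mE x y i j)).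
    by have := pairing_t adj_s (adj_u x t) (adj_k x t) i j (DYt x t) (DYt x t); rewrite ?l1E !lE.
  have [_ [_ [_ [Hr Hi]]]] := HMreal i (ltn_ltP i) im0.
  (* On the diagonal [L] and [L'] contribute the sum of the parameter and its conjugate, as in
     [omega_t]. *)
  have -> : (Z x t *m s *m Ym x t *m L + L' *m Z x t *m s *m Ym x t
             + Z x t *m u x t *m Ym x t) i i =
      Ci * omega_t N.+1 k (lams i) (lams i) (Qof k (q x t)) (Phis i x t) (Phis i x t).
    have -> : L' *m Z x t *m s *m Ym x t = L' *m (Z x t *m s *m Ym x t) by rewrite !mulmxA.
    rewrite !mx_entryD eL eR.
    rewrite -!(mulmxA (Z x t)) /s /u /isigma -!scalemxAl -!scalemxAr !mx_entryZ !cols_mul !ZE.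
    rewrite /omega_t; move: (cdot _ _ _) (cdot _ _ _) (lams i) (Cconj (lams i)) => b a e c.
    rewrite (_ : Cadd _ _ = (e + c) * a + b) //.
    by ring.
  have := is_dC_scale Ci (conj (Hr x t) (Hi x t)).
  by apply: is_dC_ext => y; rewrite mxE [mx _ _ _ _ _]mxE.
have phnE x t : cols N.+1 1 (fun=> Phin x t) = phn x t.
  rewrite /phn /w /om -!scalemxAr -scalemxAl scalerA mulrN CiCi opprK scale1r.
  rewrite (_ : Ym x t *m _ = mx N.+1 n (mmul n (Y x t) (Minv x t))); last by rewrite mx_mul.
  rewrite cols_mul.
  by apply/matrixP => i j; rewrite !mxE.
(* Since P = -i Y M^-1 Y^dagger Lambda, the i of [s] cancels and [s, P] =
   [sigma_3, Y M^-1 Y^dagger Lambda]. *)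
have uDE x t : Ci *: mx N.+1 N.+1 (Qn x t) = u x t + Dp x t.
  rewrite mx_sub scalerBr mx_scale scalerA CiCi scaleN1r opprK mx_comm; congr (_ + _).
  rewrite !mx_mul mx_adj /Dp /P /Z /w /s /isigma -!(scalemxAl, scalemxAr) !scalerA.
  by rewrite mulrN mulNr CiCi opprK !scale1r !mulmxA.
have Dpx x t : is_dM (fun y => P y t) x (E x t).
  by have := dressed_potential_x adj_s (adj_u x t) (fun y => mw y t) (DYx x t) (Dmx x t).
(* Q[n] = -i (u + [s, P]) has x-derivative Q_x - i [s, E]. The [inord] extends it to all natural
   indices; those above N are read as 0. *)
pose Qnx x t : mat := fun a b =>
  (mx N.+1 N.+1 (Qx x t) - Ci *: (s *m E x t - E x t *m s)) (inord a) (inord b).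
have QnxE x t : mx N.+1 N.+1 (Qnx x t) =
    mx N.+1 N.+1 (Qx x t) - Ci *: (s *m E x t - E x t *m s).
  by apply/matrixP => i j; rewrite mxE /Qnx !inord_val.
have uxE x t : Ci *: mx N.+1 N.+1 (Qnx x t) = ux x t + (s *m E x t - E x t *m s).
  by rewrite QnxE scalerBr scalerA CiCi scaleN1r opprK.
exists Qnx; split; [|split].
- apply: mx_mpd_x => x t; rewrite QnxE.
  have DQ := mpd_x_mx HQx x t.
  have DD := is_dM_add (is_dM_mull s (Dpx x t)) (is_dM_opp (is_dM_mulr s (Dpx x t))).
  apply: is_dM_ext (is_dM_add DQ (is_dM_opp (is_dM_scale Ci DD))) => y.
  (* After multiplication by i the goal is [uDE]. *)
  apply: (scalerI (a := Ci)); first by apply/eqP/Ci_neq_0.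
  by rewrite uDE scalerBr scalerA CiCi scaleN1r opprK.
- apply: cols_lax_x => x t; rewrite uDE phnE.
  apply: (@is_dM_ext _ _ _ (fun y => phn y t)) => [y|]; first by rewrite phnE.
  apply: (dressed_lax_x (fun y => mw y t) (mL x t) (Lom x t)) => //.
  by have := Dphx x t; rewrite L1E mulmxDl -scalemxAl.
- apply: cols_lax_t => x t; rewrite uDE uxE phnE.
  apply: (@is_dM_ext _ _ _ (fun y => phn x y)) => [y|]; first by rewrite phnE.
  have kE : kk x t = Chalf *: (s *m (u x t *m u x t - ux x t)) by [].
  (* Identifies [kk + E] with the dispersion term of the dressed potential, so that [dressed_lax_t]
     applies. *)
  have := dressing_potential (mw x t) (mulmx1C (mw x t)) (mL x t) (isigma_sqr _) (us x t) Chalf_add kE.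
  rewrite -/(E x t) -/(P x t) -/(Dp x t) => EE.
  rewrite /dispersion -EE.
  apply: (dressed_lax_t (fun y => mw x y) (mL x t) (Lom x t)) => //.
  by have := Dpht x t; rewrite !L1E !mulmxDl scalerA -!scalemxAl.
Qed.
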